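(* For every positive integer $n\equiv 0\pmod{14}$ there is a $\left(\frac{13n}{14}-2\right)$-regular maximal $(2,3)$-antichain on $n$ points, and for every positive integer $n\equiv 0\pmod{16}$ there is a $\left(\frac{15n}{16}-2\right)$-regular maximal $(2,3)$-antichain on $n$ points.
   Context: Let $[n]=\{1,2,\ldots,n\}$. A maximal $(2,3)$-antichain on $n$ points is a family $\mathcal{A}=\mathcal{A}_2\cup\mathcal{A}_3$ with $\mathcal{A}_2\subseteq\binom{[n]}{2}$ (2-element subsets) and $\mathcal{A}_3\subseteq\binom{[n]}{3}$ (3-element subsets) such that (1) no member of $\mathcal{A}$ is a subset of another member of $\mathcal{A}$, and (2) for every $X\in 2^{[n]}\setminus\mathcal{A}$ there is an $A\in\mathcal{A}$ with $X\subseteq A$ or $A\subseteq X$. It is $r$-regular if every element of $[n]$ is contained in exactly $r$ members of $\mathcal{A}$. *)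

(* Defs.v *)
From mathcomp Require Import all_boot.

Set Implicit Arguments.
Unset Strict Implicit.
Unset Printing Implicit Defensive.

(* The ground set [n] = {1, ..., n} is represented by 'I_n = {0, ..., n-1}.
   Either of the two levels of a (2,3)-family may be empty. *)

Definition family23 (n : nat) (F : {set {set 'I_n}}) : Prop :=
  forall A, A \in F -> #|A| = 2 \/ #|A| = 3.

Definition antichain (n : nat) (F : {set {set 'I_n}}) : Prop :=
  forall A B, A \in F -> B \in F -> A \subset B -> A = B.

(* X ranges over subsets of all sizes, not only of sizes 2 and 3. *)
Definition saturated (n : nat) (F : {set {set 'I_n}}) : Prop :=
  forall X : {set 'I_n}, X \notin F ->
    exists2 A, A \in F & X \subset A \/ A \subset X.

Definition maximal_antichain23 (n : nat) (F : {set {set 'I_n}}) : Prop :=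
  [/\ family23 F, antichain F & saturated F].

Definition regular (n r : nat) (F : {set {set 'I_n}}) : Prop :=
  forall x : 'I_n, #|[set A in F | x \in A]| = r.

(* Main.v *)
Require Import Defs.
From HB Require Import structures.
From mathcomp Require Import all_boot.
From mathcomp Require Import zify.

(* A maximal (2,3)-antichain consists of the non-edges and the triangles of a
   graph in which every edge lies in a triangle, and a vertex x is then in
   n - 1 - d(x) + t(x) members, d(x) being its degree and t(x) the number of
   triangles through it.  So for n = 2mk, with m = 7 or m = 8, it is enough that
   d(x) - t(x) = k + 1 for all x.  Take the vertices (i, b, j) with i in Z/m,
   b in {0, 1} and j < k; join (i, b, j) to its mate (i, 1 - b, j) and to all
   vertices with first coordinate i + 1 + b.  As sums of at most three elements
   of {1, 2} are nonzero mod m, the only triangles are a vertex together with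
   two mates it points to, so d(x) = 4k + 1 and t(x) = 3k. *)

Set Implicit Arguments.
Unset Strict Implicit.
Unset Printing Implicit Defensive.

(** * Non-edges and triangles of a graph *)

Section FlatAntichain.

Variables (T : finType) (e : rel T).

Definition clique (A : {set T}) : bool :=
  [forall y in A, forall z in A, (y != z) ==> e y z].

Definition flat : {set {set T}} :=
  [set A : {set T} | (#|A| == 2) && ~~ clique A || (#|A| == 3) && clique A].

Definition triangles (x : T) : {set {set T}} :=
  [set A : {set T} | [&& #|A| == 3, clique A & x \in A]].

Lemma cliqueP (A : {set T}) :
  reflect {in A &, forall y z, y != z -> e y z} (clique A).
Proof.
apply: (iffP forall_inP) => [h y z Ay Az yz | h y Ay].
  by have /forall_inP/(_ z Az)/implyP := h y Ay; apply.
by apply/forall_inP => z Az; apply/implyP; apply: h.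
Qed.

Hypothesis e_sym : symmetric e.

Lemma clique2 (x y : T) : x != y -> clique [set x; y] = e x y.
Proof.
move=> xy; apply/cliqueP/idP => [h | exy u v].
  by apply: h; rewrite ?set21 ?set22.
by move=> /set2P[] -> /set2P[] ->; rewrite ?eqxx // e_sym.
Qed.

Lemma clique3 (x y z : T) : x != y -> x != z -> y != z ->
  clique [set x; y; z] = [&& e x y, e x z & e y z].
Proof.
move=> xy xz yz; apply/cliqueP/and3P => [h | [exy exz eyz] u v].
  by split; apply: h; rewrite ?inE ?eqxx ?orbT.
rewrite !inE -!orbA => /or3P[] /eqP -> /or3P[] /eqP ->;
  by rewrite ?eqxx // e_sym.
Qed.

Lemma cards3 (x y z : T) : x != y -> x != z -> y != z ->
  #|[set x; y; z]| = 3.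
Proof.
by move=> xy xz yz; rewrite setUC cardsU1 !inE cards2 eq_sym (negPf xz) eq_sym
  (negPf yz) xy.
Qed.

Lemma cards3_memP (A : {set T}) (x : T) : #|A| == 3 -> x \in A ->
  exists y z, [/\ x != y, x != z, y != z & A = [set x; y; z]].
Proof.
move=> A3 xA; have /cards2P[y [z [yz AE]]] : #|A :\ x| == 2.
  by move: A3; rewrite (cardsD1 x A) xA.
have := setD11 x A; rewrite AE !inE => /negbT; rewrite negb_or => /andP[xy xz].
by exists y, z; split=> //; rewrite -(setD1K xA) AE setUA.
Qed.

(** The map [y |-> [set x; y]] is a bijection from the non-neighbours of [x] other than [x] to the
    2-sets of the family through [x]. Being a clique or not separates these from the triangles. *)
Lemma card_flat_at (x : T) :
  #|[set A in flat | x \in A]|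
  = #|[set y | (y != x) && ~~ e x y]| + #|triangles x|.
Proof.
pose P := [set [set x; y] | y in [set y | (y != x) && ~~ e x y]].
have -> : #|[set y | (y != x) && ~~ e x y]| = #|P|.
  rewrite card_in_imset // => y z; rewrite !inE => /andP[yx _] _ /setP/(_ y).
  by rewrite !inE (negPf yx) eqxx => /esym/eqP.
have PE A : (A \in P) = [&& #|A| == 2, ~~ clique A & x \in A].
  apply/imsetP/and3P => [[y] | [A2 nA xA]].
    rewrite inE => /andP[yx nexy] ->.
    by rewrite eq_sym in yx; rewrite cards2 yx clique2 // nexy !inE eqxx.
  have /cards1P[y AE] : #|A :\ x| == 1.
    by move: A2; rewrite (cardsD1 x A) xA.
  have := setD11 x A; rewrite AE inE => /negbT xy.
  have AE' : A = [set x; y] by rewrite -(setD1K xA) AE.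
  by exists y; rewrite // inE eq_sym xy /=; rewrite -clique2 // -AE'.
rewrite -cardsUI (_ : P :&: triangles x = set0) ?cards0 ?addn0; last first.
  apply/setP => A; rewrite in_setI PE !inE.
  by case: (clique A); rewrite /= ?andbF.
congr #|pred_of_set _|; apply/setP => A; rewrite in_setU PE !inE.
by rewrite andb_orl -!andbA.
Qed.

Lemma clique_sub (A B : {set T}) : A \subset B -> clique B -> clique A.
Proof.
move=> /subsetP sAB /cliqueP hB; apply/cliqueP => y z /sAB By /sAB Bz.
exact: hB.
Qed.

End FlatAntichain.

(** A proper inclusion would put a non-edge inside a triangle. For saturation, a non-clique contains
    a non-edge, a clique on three or more vertices contains a triangle, and a smaller clique extends
    to an edge and then to a triangle. *)
Lemma flat_maximal (n : nat) (e : rel 'I_n) : 0 < n ->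
    symmetric e -> irreflexive e -> (forall x, exists y, e x y) ->
    (forall x y, e x y -> exists2 z, e x z & e y z) ->
  maximal_antichain23 (flat e).
Proof.
move=> n_gt0 e_sym e_irr e_nbr e_tri.
have e_neq x y : e x y -> x != y by apply: contraTneq => ->; rewrite e_irr.
have in_tri x y : e x y -> exists2 A, A \in flat e & [set x; y] \subset A.
  move=> exy; have [z exz eyz] := e_tri x y exy.
  exists [set x; y; z]; last exact: subsetUl.
  by rewrite inE cards3 ?clique3 ?exy ?exz ?eyz ?e_neq.
split.
- by move=> A; rewrite inE => /orP[] /andP[/eqP]; [left | right].
- move=> A B; rewrite !inE => hA hB sAB.
  have le := subset_leq_card sAB.
  apply/eqP; rewrite eqEcard sAB.
  case/orP: hA hB le => /andP[/eqP -> cA] /orP[] /andP[/eqP -> cB] //.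
  by rewrite (clique_sub sAB cB) in cA.
move=> X XF; case: (boolP (clique e X)) => [cX | ncX]; last first.
  have /forall_inPn[y yX /forall_inPn[z zX]] := ncX.
  rewrite negb_imply => /andP[yz neyz]; exists [set y; z].
    by rewrite inE cards2 yz clique2 // neyz.
  by right; apply/subsetP => u /set2P[] ->.
have [X2 | X2] := ltnP 2 #|X|.
  have /card_gt2P[x [y [z [[xX yX zX] [xy yz]]]]] := X2.
  rewrite eq_sym => xz; exists [set x; y; z]; last first.
    by right; apply/subsetP => u; rewrite !inE -orbA => /or3P[] /eqP ->.
  have sX : [set x; y; z] \subset X.
    by apply/subsetP => u; rewrite !inE -orbA => /or3P[] /eqP ->.
  by rewrite inE cards3 // (clique_sub sX cX) orbT.
have [X1 | X1] := ltnP 1 #|X|.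
  have /cards2P[x [y [xy XE]]] : #|X| == 2 by rewrite eqn_leq X2.
  have exy : e x y by rewrite XE clique2 in cX.
  by have [A FA sA] := in_tri x y exy; exists A => //; left; rewrite XE.
(* The empty set is handled together with the singletons; it needs some vertex, hence [0 < n]. *)
have [x sX] : exists x, X \subset [set x].
  have [->|[x xX]] := set_0Vmem X.
    by exists (Ordinal n_gt0); apply: sub0set.
  exists x; apply/subsetP => y yX; rewrite inE.
  by apply/eqP; apply: (card_le1_eqP X1).
have [y exy] := e_nbr x; have [A FA sA] := in_tri x y exy.
exists A => //; left; apply: subset_trans sX (subset_trans _ sA).
by rewrite sub1set set21.
Qed.

(** * Transport of the family along a bijection of vertices *)

Lemma flat_imset (S T : finType) (f : S -> T) (e : rel T) (A : {set S}) :
  injective f -> (A \in flat (relpre f e)) = (f @: A \in flat e).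
Proof.
move=> f_inj; rewrite !inE card_imset //.
suff -> : clique (relpre f e) A = clique e (f @: A) by [].
apply/cliqueP/cliqueP => h.
  move=> _ _ /imsetP[y Ay ->] /imsetP[z Az ->]; rewrite inj_eq //.
  exact: h.
by move=> y z Ay Az yz; apply: h; rewrite ?mem_imset ?inj_eq.
Qed.

Lemma card_flat_relpre (S T : finType) (f : S -> T) (e : rel T) (x : S) :
  bijective f ->
  #|[set A in flat (relpre f e) | x \in A]| = #|[set B in flat e | f x \in B]|.
Proof.
move=> f_bij; have f_inj := bij_inj f_bij; case: f_bij => g fK gK.
rewrite -(card_imset _ (imset_inj f_inj)); congr #|pred_of_set _|.
apply/setP => B; have BE : B = f @: (g @: B).
  by rewrite -imset_comp (eq_imset _ gK) imset_id.
rewrite BE mem_imset; last exact: imset_inj.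
by rewrite [LHS]in_set [RHS]in_set flat_imset // mem_imset.
Qed.

(** * The graph of mates and arcs, over abstract shifts *)

Section PairGraph.

Variables (I : finType) (s : bool -> I -> I) (k : nat).

(** Call the first coordinate of a vertex its class. [s_inj] fixes the in-degrees, [s_neq] keeps two
    mates from pointing to the same class, and [s_no1], [s_no2], [s_no3] exclude arcs inside a
    class, opposite arcs and directed triangles. *)
Hypothesis s_inj : forall b, injective (s b).
Hypothesis s_neq : forall i, s false i != s true i.
Hypothesis s_no1 : forall b i, s b i != i.
Hypothesis s_no2 : forall b c i, s b (s c i) != i.
Hypothesis s_no3 : forall b c d i, s b (s c (s d i)) != i.

Definition vertex : Type := (I * bool * 'I_k)%type.
HB.instance Definition _ := Finite.on vertex.

Definition mate (x : vertex) : vertex := (x.1.1, ~~ x.1.2, x.2).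
Definition arc (x y : vertex) : bool := y.1.1 == s x.1.2 x.1.1.
Definition adj (x y : vertex) : bool := [|| y == mate x, arc x y | arc y x].

Lemma mateK : involutive mate.
Proof. by case=> [[i b] j]; rewrite /mate /= negbK. Qed.

Lemma mate_eqC (x y : vertex) : (y == mate x) = (x == mate y).
Proof. by rewrite -(inj_eq (can_inj mateK)) mateK eq_sym. Qed.

Lemma mate_neq (x : vertex) : mate x != x.
Proof. by apply/eqP => /(congr1 (fun y => y.1.2)) /=; case: (x.1.2). Qed.

Lemma arc_mate (x y : vertex) : arc x (mate y) = arc x y.
Proof. by []. Qed.

Lemma arc_neq (x y : vertex) : arc x y -> x.1.1 != y.1.1.
Proof. by move=> /eqP ->; rewrite eq_sym s_no1. Qed.

Lemma arc_mate_neq (x y : vertex) : arc x y -> arc (mate x) y = false.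
Proof.
rewrite /arc /= => /eqP ->; case: (x.1.2) => /=; last exact/negbTE.
by rewrite eq_sym; apply/negbTE.
Qed.

Lemma arc_asym (x y : vertex) : arc x y -> arc y x = false.
Proof. by rewrite /arc => /eqP ->; rewrite eq_sym; apply/negbTE. Qed.

Lemma adj_sym : symmetric adj.
Proof. by move=> x y; rewrite /adj mate_eqC (orbC (arc x y)). Qed.

Lemma adj_irr : irreflexive adj.
Proof.
move=> x; rewrite /adj /arc eq_sym (negbTE (mate_neq x)) /= orbb.
by rewrite eq_sym; apply/negbTE.
Qed.

Lemma arc_out (x y z : vertex) : arc x y -> arc x z -> arc y z = false.
Proof.
by rewrite /arc => /eqP xy /eqP ->; rewrite -xy eq_sym; apply/negbTE.
Qed.

Lemma arc_cycle (x y z : vertex) : arc x y -> arc y z -> arc z x = false.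
Proof.
by rewrite /arc => /eqP xy /eqP ->; rewrite xy eq_sym; apply/negbTE.
Qed.

(** Of the eight orientations two are cyclic, excluded by [arc_cycle]. In the other six a source
    points to both other vertices, which then share a class and span no arc. *)
Lemma arc_no_triangle (x y z : vertex) :
  arc x y || arc y x -> arc y z || arc z y -> arc x z || arc z x -> False.
Proof.
have out := arc_out; have cyc := arc_cycle.
move=> /orP[] a1 /orP[] a2 /orP[] a3.
- by rewrite (out _ _ _ a1 a3) in a2.
- by rewrite (cyc _ _ _ a1 a2) in a3.
- by rewrite (out _ _ _ a3 a1) in a2.
- by rewrite (out _ _ _ a3 a2) in a1.
- by rewrite (out _ _ _ a1 a2) in a3.
- by rewrite (out _ _ _ a2 a1) in a3.
- by rewrite (cyc _ _ _ a3 a2) in a1.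
- by rewrite (out _ _ _ a2 a3) in a1.
Qed.

(** An arc from [y] to [x] would leave no way to join [x] to [mate y]: two mates point to different
    classes, and an arc from [x] to [mate y] is also one to [y]. *)
Lemma arc_of_adj_mates (x y : vertex) : x != y -> x != mate y ->
  adj x y -> adj x (mate y) -> arc x y.
Proof.
move=> xy xmy; rewrite /adj mate_eqC (negbTE xmy) /= => /orP[//|ayx].
rewrite (inj_eq (can_inj mateK)) eq_sym (negbTE xy) /=.
by rewrite arc_mate (arc_asym ayx) (arc_mate_neq ayx).
Qed.

Lemma adj_mate (x : vertex) : adj x (mate x).
Proof. by rewrite /adj eqxx. Qed.

Lemma adj_arc (x y : vertex) : arc x y -> adj x y.
Proof. by rewrite /adj => ->; rewrite orbT. Qed.

Lemma adj_cra (x y : vertex) : arc x y -> adj y x.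
Proof. by rewrite /adj => ->; rewrite !orbT. Qed.

Lemma arc_neq_vertex (x y : vertex) : arc x y -> x != y.
Proof. by move=> /arc_neq; apply: contraNneq => ->. Qed.

Definition in_nbrs (x : vertex) : {set vertex} := [set y | arc y x].
(** The member with bit [false] represents its mate pair, so that the triangle formed by [x] and the
    pair is counted once. *)
Definition out_pairs (x : vertex) : {set vertex} := [set y | arc x y && ~~ y.1.2].

Lemma in_nbrP (x : vertex) (b : bool) (j : 'I_k) :
  exists2 i, ((i, b, j) : vertex) \in in_nbrs x & s b i = x.1.1.
Proof.
have [g gK Kg] := injF_bij (@s_inj b).
by exists (g x.1.1) => //; rewrite inE /arc /= Kg.
Qed.

(** Since each [s b] is a permutation, an in-neighbour is determined by its bit and index, and every
    such pair occurs. *)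
Lemma card_in_nbrs (x : vertex) : #|in_nbrs x| = k.*2.
Proof.
have <- : #|(fun y : vertex => (y.1.2, y.2)) @: in_nbrs x| = #|in_nbrs x|.
  apply: card_in_imset => -[[i b] j] [[i' b'] j']; rewrite !inE /arc /=.
  by move=> /eqP -> /eqP + [eb ej]; rewrite -eb ej => /s_inj ->.
rewrite (_ : _ @: _ = setT) ?cardsT ?card_prod ?card_bool ?card_ord ?mul2n //.
apply/setP => -[b j]; rewrite inE; apply/imsetP.
by have [i ix _] := in_nbrP x b j; exists (i, b, j).
Qed.

Lemma card_out_pairs (x : vertex) : #|out_pairs x| = k.
Proof.
have -> : out_pairs x = [set (s x.1.2 x.1.1, false, j) | j in 'I_k].
  apply/setP => -[[i b] j]; rewrite inE /arc /=.
  apply/andP/imsetP => [[/eqP -> /negbTE ->] | [j' _ [-> -> _]]]; last by [].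
  by exists j.
by rewrite card_imset ?card_ord // => j j' [].
Qed.

Lemma card_out_nbrs (x : vertex) : #|[set y | arc x y]| = k.*2.
Proof.
have -> : [set y | arc x y] =
    [set (s x.1.2 x.1.1, p.1, p.2) | p in {: bool * 'I_k}].
  apply/setP => -[[i b] j]; rewrite inE /arc /=.
  by apply/eqP/imsetP => [-> | [[b' j'] _ [-> _ _]]] //; exists (b, j).
rewrite card_imset ?card_prod ?card_bool ?card_ord ?mul2n //.
by move=> [b j] [b' j'] [-> ->].
Qed.

Lemma card_non_nbrs (x : vertex) :
  #|[set y | (y != x) && ~~ adj x y]| + (k.*2.*2 + 2) = #|{: vertex}|.
Proof.
pose N := [set x; mate x] :|: ([set y | arc x y] :|: in_nbrs x).
have <- : #|N| = k.*2.*2 + 2.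
  rewrite /N cardsU (_ : _ :&: _ = set0) ?cards0 ?subn0; last first.
    apply/setP => y; rewrite !inE; apply/negbTE/negP.
    case/andP => /orP[]/eqP ->.
      by rewrite /arc orbb eq_sym (negbTE (s_no1 _ _)).
    by rewrite /arc /= !(eq_sym x.1.1) !(negbTE (s_no1 _ _)).
  rewrite cards2 eq_sym mate_neq cardsU (_ : _ :&: _ = set0).
    by rewrite cards0 subn0 card_out_nbrs card_in_nbrs addnn addnC.
  by apply/setP => y; rewrite !inE; apply/negbTE/negP => /andP[/arc_asym ->].
rewrite -(cardsC N) addnC; congr (_ + #|pred_of_set _|).
by apply/setP => y; rewrite !inE /adj !negb_or -!andbA.
Qed.

(** By [arc_no_triangle] two vertices of a triangle are mates, and [arc_of_adj_mates] makes the
    third one point to both. The two sets correspond to [x] being outside or inside the mate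
    pair. *)
Lemma trianglesE (x : vertex) : triangles adj x =
  [set [set x; y; mate y] | y in out_pairs x]
    :|: [set [set x; mate x; y] | y in in_nbrs x].
Proof.
have sym := adj_sym.
apply/setP => A; rewrite !inE; apply/and3P/orP => [[A3 cA xA] | ].
  have [y [z [xy xz yz AE]]] := cards3_memP A3 xA.
  move: cA; rewrite {}AE clique3 // => /and3P[axy axz ayz] {A A3 xA}.
  have [zE | zNE] := eqVneq z (mate y).
    left; subst z; have a := arc_of_adj_mates xy xz axy axz; apply/imsetP.
    case yb : y.1.2; last by exists y; rewrite // inE a yb.
    (* Here [y] has bit [true], so its mate is the representative. *)
    exists (mate y); rewrite ?inE ?arc_mate ?a /= ?yb //.
    by rewrite mateK -!setUA (setUC [set y]).
  have [yE | yNE] := eqVneq y (mate x).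
    right; subst y; apply/imsetP; exists z => //; rewrite inE.
    by rewrite arc_of_adj_mates // ?(eq_sym z) ?(sym z).
  have [zE | zNE'] := eqVneq z (mate x).
    right; subst z; apply/imsetP; exists y.
      by rewrite inE arc_of_adj_mates // ?(eq_sym y) ?(sym y).
    by rewrite -!setUA (setUC [set y]).
  move: axy axz ayz; rewrite /adj (negbTE zNE) (negbTE zNE') (negbTE yNE) /=.
  by move=> h1 h2 h3; case: (arc_no_triangle h1 h3 h2).
case=> /imsetP[y]; rewrite inE.
  case/andP=> a _ ->; have a' : arc x (mate y) by [].
  have d1 := arc_neq_vertex a; have d2 := arc_neq_vertex a'.
  have d3 : y != mate y by rewrite eq_sym mate_neq.
  rewrite cards3 // clique3 //; split=> //; last by rewrite !inE eqxx.
  by rewrite (adj_mate y) (adj_arc a) (adj_arc a').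
move=> a ->; have a' : arc y (mate x) by [].
have d1 : x != y by rewrite eq_sym arc_neq_vertex.
have d2 : mate x != y by rewrite eq_sym arc_neq_vertex.
have d3 : x != mate x by rewrite eq_sym mate_neq.
rewrite cards3 // clique3 //; split=> //; last by rewrite !inE eqxx.
by rewrite adj_mate (adj_cra a) (adj_cra a').
Qed.

Lemma card_triangles (x : vertex) : #|triangles adj x| = k + k.*2.
Proof.
rewrite trianglesE cardsU (_ : _ :&: _ = set0) ?cards0 ?subn0; last first.
  apply/setP => A; rewrite !inE; apply/negbTE/negP => /andP[/imsetP[y + ->]].
  (* Triangles of the second kind contain [mate x]; those of the first kind do not, as arcs change
     the class. *)
  rewrite inE => /andP[a _] /imsetP[z _ /setP/(_ (mate x))].
  rewrite !inE eqxx orbT (negbTE (mate_neq x)) /=.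
  have m1 : mate x == y = false.
    by apply: contraTF (arc_neq a) => /eqP <-; rewrite eqxx.
  have m2 : mate x == mate y = false.
    apply: contraTF (arc_neq a) => /eqP/(congr1 (fun z => z.1.1)) /= ->.
    by rewrite eqxx.
  by rewrite m1 m2.
congr (_ + _).
  rewrite card_in_imset ?card_out_pairs // => y z; rewrite !inE.
  (* Membership of [y] leaves [y = z] or [y = mate z], and the latter contradicts both bits being
     [false]. *)
  case/andP=> ay yb /andP[az zb] /setP/(_ y); rewrite !inE eqxx orbT /=.
  rewrite eq_sym (negbTE (arc_neq_vertex ay)) /= => /esym/orP[/eqP // | /eqP yE].
  by rewrite yE /= (negbTE zb) in yb.
rewrite card_in_imset ?card_in_nbrs // => y z; rewrite !inE.
move=> ay az /setP/(_ y); rewrite !inE eqxx orbT (negbTE (arc_neq_vertex ay)) /=.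
have a' : arc y (mate x) by [].
by rewrite (negbTE (arc_neq_vertex a')) => /esym/eqP.
Qed.

Lemma card_flat_adj (x : vertex) :
  #|[set A in flat adj | x \in A]| = #|{: vertex}| - k - 2.
Proof.
rewrite card_flat_at; last exact: adj_sym.
have := card_non_nbrs x; rewrite card_triangles; lia.
Qed.

(** Two mates share an in-neighbour; an arc is completed by the mate of its head. *)
Lemma adj_triangle (x y : vertex) : adj x y -> exists2 z, adj x z & adj y z.
Proof.
case/or3P=> [/eqP -> | a | a].
- have [i ai _] := in_nbrP x false x.2; rewrite inE in ai.
  by exists (i, false, x.2); apply: adj_cra.
- by exists (mate y); rewrite ?adj_mate // adj_arc.
- by exists (mate x); rewrite ?adj_mate // adj_arc.
Qed.

End PairGraph.

(** * The cyclic instance and the theorem *)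

Lemma regular_antichain (m k n : nat) : 6 < m -> 0 < k -> n = 2 * m * k ->
  exists F : {set {set 'I_n}},
    maximal_antichain23 F /\ regular (n - k - 2) F.
Proof.
move=> m_gt6 k_gt0 nE.
pose s (b : bool) := iter b.+1 (@ordS m).
have s_val c i : val (iter c (@ordS m) i) = (i + c) %% m.
  elim: c => [|c IHc] /=; first by rewrite addn0 modn_small.
  by rewrite IHc -addn1 modnDml addn1 addnS.
(* Three shifts by at most 2 add up to at most 6, whence the bounds on [c] and [m]. *)
have no_fix c i : 0 < c < 7 -> iter c (@ordS m) i != i.
  move=> /andP[c_gt0 c_lt7]; apply/eqP => /(congr1 val).
  rewrite s_val => ic; have : i + c = i + 0 %[mod m].
    by rewrite addn0 ic modn_small.
  move/eqP; rewrite eqn_modDl mod0n modn_small; last exact: leq_trans m_gt6.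
  by case: c c_gt0 {c_lt7 ic}.
have s_inj b : injective (s b).
  by rewrite /s; case: b => i j; do ?move/ordS_inj.
have s_neq i : s false i != s true i.
  by rewrite (inj_eq (@ordS_inj m)) eq_sym (no_fix 1).
have s1 b i : s b i != i by apply: no_fix; case: b.
have s2 b c i : s b (s c i) != i.
  by rewrite /s -iterD no_fix //; case: b; case: c.
have s3 b c d i : s b (s c (s d i)) != i.
  by rewrite /s -!iterD no_fix //; case: b; case: c; case: d.
have cardV : #|{: vertex 'I_m k}| = n.
  by rewrite !card_prod !card_ord card_bool nE mulnAC mulnC mulnA (mulnC 2); lia.
pose f (x : 'I_n) : vertex 'I_m k := enum_val (cast_ord (esym cardV) x).
have f_bij : bijective f.
  apply: bij_comp; first exact: enum_val_bij.
  by apply: (Bijective (cast_ordK _) (cast_ordKV _)).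
have [g fK gK] := f_bij.
exists (flat (relpre f (adj s (k := k)))); split; last first.
  by move=> x; rewrite card_flat_relpre // card_flat_adj // cardV.
apply: flat_maximal.
- lia.
- by move=> x y; apply: adj_sym.
- by move=> x; apply: adj_irr.
- by move=> x; exists (g (mate (f x))); rewrite /= gK adj_mate.
- move=> x y /= /(adj_triangle s_inj)[z xz yz].
  by exists (g z); rewrite /= gK.
Qed.

(* The quotients are exact, and the subtractions are not truncated since n > 0. *)
Theorem theorem7 :
  (forall n : nat, 0 < n -> 14 %| n ->
     exists F : {set {set 'I_n}},
       maximal_antichain23 F /\ regular (13 * n %/ 14 - 2) F) /\
  (forall n : nat, 0 < n -> 16 %| n ->
     exists F : {set {set 'I_n}},
       maximal_antichain23 F /\ regular (15 * n %/ 16 - 2) F).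
Proof.
split=> n n_gt0 /dvdnP[k nE].
  have -> : 13 * n %/ 14 = n - k by lia.
  by apply: (@regular_antichain 7); lia.
have -> : 15 * n %/ 16 = n - k by lia.
by apply: (@regular_antichain 8); lia.
Qed.
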